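(* Let $s\ge 1$ and let $b_i, a_{ij}$ ($i,j=1,\dots,s$) be real Runge--Kutta coefficients satisfying the stability condition: $b_i\ge 0$ for all $i=1,\dots,s$, and the symmetric matrix $\mathbf{M}=(\mathbf{M}_{ij})$ with $\mathbf{M}_{ij}=b_ia_{ij}+b_ja_{ji}-b_ib_j$ is positive semi-definite. Then the $s$-stage LEQRK scheme with these coefficients is unconditionally energy stable: for every time step $\Delta t>0$, every given $(\Phi^n,q^n)$ and every given extrapolated values $\Phi_N(t_n+c_i\Delta t)$, $i=1,\dots,s$, any $(\Phi^{n+1},q^{n+1})$ produced by the scheme satisfies $$\mathcal{F}^{n+1}\le \mathcal{F}^n,\qquad \text{where } \mathcal{F}^n=\tfrac12(\Phi^n,\mathcal{L}\Phi^n)+\|q^n\|^2-C|\Omega|.$$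
   Context: Setting. $\Omega$ is a bounded spatial domain and $\Phi=(\phi_1,\dots,\phi_d)^T$ is a $d$-component state variable on $\Omega$. The inner product is $(\mathbf{f},\mathbf{g})=\sum_i\int_\Omega f_ig_i\,d\mathbf{x}$ (for scalar functions, the usual $L^2$ inner product), with $\|\mathbf f\|^2=(\mathbf f,\mathbf f)$. Boundary conditions are periodic, or such that all boundary integrals arising from integration by parts vanish; functions are assumed regular enough for all expressions to make sense. The gradient flow is $\partial_t\Phi=\mathcal{G}\,\frac{\delta F}{\delta\Phi}$ with $F=\frac12(\Phi,\mathcal{L}\Phi)+(f(\Phi,\nabla\Phi),1)$. Here $\mathcal{L}$ is a linear, self-adjoint, positive semi-definite operator independent of $\Phi$ (written $\mathcal{L}=\mathcal{A}^*\mathcal{A}$ with $\mathcal{A}$ linear and $\mathcal{A}^*$ its adjoint). The mobility operator $\mathcal{G}$ (a $d\times d$ matrix operator) is negative semi-definite: $(v,\mathcal{G}v)\le 0$ for all $v$. The function $f$ is bounded below, and $C>0$ is a constant such that $f+C>0$. Put $g[\Phi]=\sqrt{f(\Phi,\nabla\Phi)+C}$. The auxiliary variable is $q=g[\Phi]$, and the quadratized energy is $\mathcal{F}=\frac12(\Phi,\mathcal{L}\Phi)+\|q\|^2-C|\Omega|$. $\frac{\partial g}{\partial\Phi}$ and $\frac{\partial g}{\partial\nabla\Phi}$ denote the partial derivatives of $g$ with respect to $\Phi$ and $\nabla\Phi$. The symbol $\cdot$ denotes full contraction over component (and derivative) indices, and $\nabla\cdot(2Q\frac{\partial g}{\partial\nabla\Phi})$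 is the $d$-vector obtained by taking the divergence componentwise. $s$-stage LEQRK scheme. Let $c_i=\sum_{j=1}^s a_{ij}$, $t_n=n\Delta t$. Given $(\Phi^n,q^n)$ and given (already known) values $\Phi_N(t_n+c_i\Delta t)$, $i=1,\dots,s$ (in practice extrapolated from earlier numerical solutions), put $$\Big(\tfrac{\partial g}{\partial\Phi}\Big)_i^{n,*}=\tfrac{\partial g}{\partial\Phi}[\Phi_N(t_n+c_i\Delta t)],\qquad \Big(\tfrac{\partial g}{\partial\nabla\Phi}\Big)_i^{n,*}=\tfrac{\partial g}{\partial\nabla\Phi}[\Phi_N(t_n+c_i\Delta t)].$$ The intermediate values $\Phi_i^n,Q_i^n,k_i^n,l_i^n$ are defined by solving, for $i=1,\dots,s$, $$\Phi_i^n=\Phi^n+\Delta t\sum_{j=1}^s a_{ij}k_j^n,\qquad Q_i^n=q^n+\Delta t\sum_{j=1}^s a_{ij}l_j^n,$$ $$k_i^n=\mathcal{G}\Big(\mathcal{L}\Phi_i^n+2Q_i^n\Big(\tfrac{\partial g}{\partial\Phi}\Big)_i^{n,*}-\nabla\cdot\Big(2Q_i^n\Big(\tfrac{\partial g}{\partial\nabla\Phi}\Big)_i^{n,*}\Big)\Big),$$ $$l_i^n=\Big(\tfrac{\partial g}{\partial\Phi}\Big)_i^{n,*}\cdot k_i^n+\Big(\tfrac{\partial g}{\partial\nabla\Phi}\Big)_i^{n,*}\cdot\nabla k_i^n,$$ and then $$\Phi^{n+1}=\Phi^n+\Delta t\sum_{i=1}^s b_ik_i^n,\qquad q^{n+1}=q^n+\Delta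 t\sum_{i=1}^s b_il_i^n.$$ *)

(* Defs.v *)
From HB Require Import structures.
From mathcomp Require Import all_boot all_order all_algebra.
From mathcomp Require Import all_classical all_reals all_analysis.
Set Implicit Arguments.
Unset Strict Implicit.
Unset Printing Implicit Defensive.
Import Order.TTheory GRing.Theory Num.Theory.
Import numFieldNormedType.Exports.
Local Open Scope classical_set_scope.
Local Open Scope ring_scope.

(* The library has Lebesgue measure on R only.  Row vectors get the sigma-algebra
   generated by the coordinates (as the library does for tuples), and Lebesgue
   measure on R^m is the m-fold product measure. *)
Section measurable_row.
Context {d} {T : sigmaRingType d}.
Variable m : nat.

Definition row_coord (i : 'I_m) (x : 'rV[T]_m) : T := x ord0 i.

Let row_set0 : g_sigma_preimage row_coord set0.
Proof. exact: sigma_algebra0. Qed.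

Let row_setC A : g_sigma_preimage row_coord A -> g_sigma_preimage row_coord (~` A).
Proof. exact: sigma_algebraC. Qed.

Let row_bigcup (F : _^nat) : (forall i, g_sigma_preimage row_coord (F i)) ->
  g_sigma_preimage row_coord (\bigcup_i (F i)).
Proof. exact: sigma_algebra_bigcup. Qed.

HB.instance Definition _ := @isMeasurable.Build (measure_tuple_display d)
  'rV[T]_m (g_sigma_preimage row_coord) row_set0 row_setC row_bigcup.

End measurable_row.

Lemma measurable_row_coord d (T : sigmaRingType d) m (i : 'I_m) :
  measurable_fun setT (@row_coord d T m i).
Proof.
move=> _ Y mY; rewrite setTI; apply: sub_sigma_algebra.
rewrite -bigcup_seq; exists i; first by rewrite /= mem_index_enum.
by exists Y => //; rewrite setTI.
Qed.

Lemma measurable_row d d' (T : measurableType d) (T' : sigmaRingType d') m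
    (f : T -> 'rV[T']_m) :
  (forall i, measurable_fun setT (row_coord i \o f)) -> measurable_fun setT f.
Proof.
move=> mf _ Y mY; rewrite setTI.
suff : measurable `<=` [set Y | measurable (f @^-1` Y)] by exact.
apply: smallest_sub => [|A].
  split=> [|A CA|F CF] /=.
  - by rewrite preimage_set0.
  - by rewrite setTD preimage_setC; exact: measurableC.
  - by rewrite preimage_bigcup; exact: bigcupT_measurable.
rewrite -bigcup_seq => -[i /= _ [B mB <-]].
by rewrite !setTI -comp_preimage -[X in measurable X]setTI; exact: mf.
Qed.

Section lebesgue_row_step.
Context {R : realType} (m : nat).

Definition row_cons (z : R * 'rV[R]_m) : 'rV[R]_m.+1 :=
  \row_i oapp (z.2 ord0) z.1 (unlift ord0 i).

Definition row_uncons (x : 'rV[R]_m.+1) : R * 'rV[R]_m :=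
  (x ord0 ord0, \row_j x ord0 (lift ord0 j)).

Lemma row_consK : cancel row_cons row_uncons.
Proof.
move=> [a v]; rewrite /row_uncons mxE unlift_none /=; congr pair.
by apply/rowP => j; rewrite !mxE liftK.
Qed.

Lemma row_unconsK : cancel row_uncons row_cons.
Proof.
move=> x; apply/rowP => i; rewrite mxE.
by case: (unliftP ord0 i) => [j|] -> /=; rewrite ?mxE.
Qed.

Lemma measurable_row_cons : measurable_fun setT row_cons.
Proof.
apply: measurable_row => i; case: (unliftP ord0 i) => [j|] ->.
  rewrite (_ : _ \o _ = row_coord j \o snd).
    by apply: measurableT_comp => //; exact: measurable_row_coord.
  by apply/funext => z; rewrite /row_coord /= mxE liftK.
rewrite (_ : _ \o _ = fst)//.
by apply/funext => z; rewrite /row_coord /= mxE unlift_none.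
Qed.

Lemma measurable_row_uncons : measurable_fun setT row_uncons.
Proof.
apply/measurable_fun_pairP; split; first exact: (measurable_row_coord ord0).
apply: measurable_row => j.
rewrite (_ : _ \o _ = row_coord (lift ord0 j)).
  exact: measurable_row_coord.
by apply/funext => x; rewrite /row_coord /= mxE.
Qed.

Variable mu : {sigma_finite_measure set 'rV[R]_m -> \bar R}.

Definition lebesgue_row_step : set 'rV[R]_m.+1 -> \bar R :=
  pushforward (@lebesgue_measure R \x mu)%E row_cons.

Let step_measurable A : measurable A -> measurable (row_cons @^-1` A).
Proof.
by move=> mA; rewrite -[X in measurable X]setTI; exact: measurable_row_cons.
Qed.

Let step0 : lebesgue_row_step set0 = 0%E.
Proof. by rewrite /lebesgue_row_step /pushforward preimage_set0 measure0. Qed.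

Let step_ge0 A : (0 <= lebesgue_row_step A)%E.
Proof. by rewrite /lebesgue_row_step /pushforward measure_ge0. Qed.

Let step_sigma_additive : semi_sigma_additive lebesgue_row_step.
Proof.
move=> F mF tF mUF; rewrite /lebesgue_row_step /pushforward preimage_bigcup.
apply: measure_semi_sigma_additive.
- by move=> n; exact: step_measurable.
- apply/trivIsetP => i j _ _ ij; rewrite -preimage_setI.
  by move/trivIsetP : tF => /(_ _ _ _ _ ij) ->//; rewrite preimage_set0.
- by rewrite -preimage_bigcup; exact: step_measurable.
Qed.

HB.instance Definition _ := isMeasure.Build _ _ _ lebesgue_row_step
  step0 step_ge0 step_sigma_additive.

Let step_sigma_finite : sigma_finite setT lebesgue_row_step.
Proof.
have /sigma_finiteP[F [TF ndF Foo]] := sigma_finiteT (@lebesgue_measure R).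
have /sigma_finiteP[G [TG ndG Goo]] := sigma_finiteT mu.
exists (fun n => row_uncons @^-1` (F n `*` G n)).
  rewrite predeqE => x; split=> // _.
  have [i _ Fi] : (\bigcup_i F i) (row_uncons x).1 by rewrite -TF.
  have [j _ Gj] : (\bigcup_i G i) (row_uncons x).2 by rewrite -TG.
  exists (maxn i j) => //; split.
  - by move: Fi; exact/subsetPset/ndF/leq_maxl.
  - by move: Gj; exact/subsetPset/ndG/leq_maxr.
move=> n; have [mF Fn] := Foo n; have [mG Gn] := Goo n; split.
  rewrite -[X in measurable X]setTI; apply: measurable_row_uncons => //.
  exact: measurableX.
rewrite /lebesgue_row_step /pushforward -comp_preimage.
rewrite (_ : row_uncons \o row_cons = id); last exact/funext/row_consK.
by rewrite preimage_id product_measure1E// lte_mul_pinfty// ge0_fin_numE.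
Qed.

HB.instance Definition _ := Measure_isSigmaFinite.Build _ _ _ lebesgue_row_step
  step_sigma_finite.

End lebesgue_row_step.

Fixpoint lebesgue_row {R : realType} (m : nat) :
    {sigma_finite_measure set 'rV[R]_m -> \bar R} :=
  match m with
  | 0 => @dirac _ 'rV[R]_0 0 R
  | m'.+1 => lebesgue_row_step (lebesgue_row m')
  end.

(* Fields on Omega are represented by functions on the whole of R^m, of which
   only the values on Omega matter: equalities between fields are stated on Omega,
   and the derivatives below only see the values on an open Omega. *)
Section fields.
Context {R : realType} {m : nat}.
Implicit Types (Omega : set 'rV[R]_m) (x : 'rV[R]_m).
Local Notation mu := (lebesgue_row m).

Definition contraction {p n} (A B : 'M[R]_(p, n)) : R :=
  \sum_i \sum_j A i j * B i j.

Definition volume Omega : R := fine (mu Omega).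

Definition inner Omega (u v : 'rV[R]_m -> R) : R :=
  \int[mu]_(x in Omega) (u x * v x).

Definition vinner Omega {d} (u v : 'rV[R]_m -> 'rV[R]_d) : R :=
  \sum_(c < d) inner Omega (fun x => u x ord0 c) (fun x => v x ord0 c).

Definition square_integrable Omega (u : 'rV[R]_m -> R) : Prop :=
  measurable_fun Omega u /\ mu.-integrable Omega (fun x => (u x ^+ 2)%:E).

Definition vsquare_integrable Omega {d} (u : 'rV[R]_m -> 'rV[R]_d) : Prop :=
  forall c, square_integrable Omega (fun x => u x ord0 c).

Definition partial (j : 'I_m) (u : 'rV[R]_m -> R) x : R :=
  'D_(delta_mx ord0 j) u x.

Definition grad {d} (u : 'rV[R]_m -> 'rV[R]_d) x : 'M[R]_(d, m) :=
  \matrix_(c, j) partial j (fun y => u y ord0 c) x.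

Definition vdiv {d} (P : 'rV[R]_m -> 'M[R]_(d, m)) x : 'rV[R]_d :=
  \row_c \sum_j partial j (fun y => P y c j) x.

Definition sdiv (W : 'rV[R]_m -> 'rV[R]_m) x : R :=
  \sum_j partial j (fun y => W y ord0 j) x.

Definition has_partials Omega {p n} (u : 'rV[R]_m -> 'M[R]_(p, n)) : Prop :=
  forall x, Omega x -> forall i j l,
    derivable (fun y => u y i j) x (delta_mx ord0 l).

(* By the divergence theorem, the left-hand side is the boundary integral of W . n;
   this form makes sense without assuming regularity of the boundary of Omega. *)
Definition boundary_integral_vanishes Omega (W : 'rV[R]_m -> 'rV[R]_m) : Prop :=
  \int[mu]_(x in Omega) sdiv W x = 0.

End fields.

Section operators.
Context {R : realType} {m d : nat} (Omega : set 'rV[R]_m).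
Local Notation vfield := ('rV[R]_m -> 'rV[R]_d).

(* [dom] is the class of admissible states: regular enough for the terms of the
   scheme and of the energy to make sense, and satisfying the (linear) boundary
   conditions. *)
Record linear_operator (dom : set vfield) (L : vfield -> vfield) : Prop := {
  dom_linear : forall (a : R) u v, dom u -> dom v -> dom (a *: u + v);
  dom_eq : forall u v, {in Omega, u =1 v} -> dom u -> dom v;
  dom_partials : forall u, dom u -> has_partials Omega u;
  dom_square_integrable : forall u, dom u -> vsquare_integrable Omega u;
  op_square_integrable : forall u, dom u -> vsquare_integrable Omega (L u);
  op_eq : forall u v, dom u -> {in Omega, u =1 v} -> {in Omega, L u =1 L v};
  op_linear : forall (a : R) u v, dom u -> dom v ->
    {in Omega, L (a *: u + v) =1 a *: L u + L v} }.

Definition self_adjoint (dom : set vfield) (L : vfield -> vfield) : Prop :=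
  forall u v, dom u -> dom v -> vinner Omega u (L v) = vinner Omega (L u) v.

Definition positive_semidefinite (dom : set vfield) (L : vfield -> vfield) : Prop :=
  forall u, dom u -> 0 <= vinner Omega u (L u).

Definition matrix_operator
    (G : 'I_d -> 'I_d -> ('rV[R]_m -> R) -> 'rV[R]_m -> R) (v : vfield) : vfield :=
  fun x => \row_c \sum_e G c e (fun y => v y ord0 e) x.

Definition negative_semidefinite (dom : set vfield) (G : vfield -> vfield) : Prop :=
  forall v, dom v -> vinner Omega v (G v) <= 0.

End operators.

Definition psd_mx {R : realType} {s : nat} (M : 'M[R]_s) : Prop :=
  M^T = M /\ forall v : 'cV[R]_s, 0 <= (v^T *m M *m v) ord0 ord0.

Section quadratization.
Context {R : realType} {m d : nat}.
Variables (f : 'rV[R]_d -> 'M[R]_(d, m) -> R) (C : R).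

Definition gfun (y : 'rV[R]_d) (p : 'M[R]_(d, m)) : R := Num.sqrt (f y p + C).

Definition dg_dPhi (Phi : 'rV[R]_m -> 'rV[R]_d) (x : 'rV[R]_m) : 'rV[R]_d :=
  \row_c 'D_(delta_mx ord0 c) (fun y => gfun y (grad Phi x)) (Phi x).

Definition dg_dgrad (Phi : 'rV[R]_m -> 'rV[R]_d) (x : 'rV[R]_m) : 'M[R]_(d, m) :=
  \matrix_(c, j) 'D_(delta_mx c j) (fun p => gfun (Phi x) p) (grad Phi x).

Definition density_regular : Prop := forall y p,
  (forall c, derivable (fun z => f z p) y (delta_mx ord0 c)) /\
  (forall c j, derivable (fun r => f y r) p (delta_mx c j)).

Definition energy (Omega : set 'rV[R]_m)
    (L : ('rV[R]_m -> 'rV[R]_d) -> 'rV[R]_m -> 'rV[R]_d)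
    (Phi : 'rV[R]_m -> 'rV[R]_d) (q : 'rV[R]_m -> R) : R :=
  2^-1 * vinner Omega Phi (L Phi) + inner Omega q q - C * volume Omega.

End quadratization.

Section scheme.
Context {R : realType} {m d s : nat}.
Local Notation sfield := ('rV[R]_m -> R).
Local Notation vfield := ('rV[R]_m -> 'rV[R]_d).
Variables (Omega : set 'rV[R]_m) (L G : vfield -> vfield)
  (f : 'rV[R]_d -> 'M[R]_(d, m) -> R) (C : R).
Variables (a : 'M[R]_s) (b : 'I_s -> R) (dt : R) (n : nat).

Definition rk_node (i : 'I_s) : R := \sum_j a i j.

Definition stage_time (i : 'I_s) : R := n%:R * dt + rk_node i * dt.

Definition stability_mx : 'M[R]_s :=
  \matrix_(i, j) (b i * a i j + b j * a j i - b i * b j).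

Definition stage_flux (PhiN : vfield) (Q : sfield) : 'rV[R]_m -> 'M[R]_(d, m) :=
  fun x => (2 * Q x) *: dg_dgrad f C PhiN x.

Definition stage_potential (PhiN Phi : vfield) (Q : sfield) : vfield :=
  fun x => L Phi x + (2 * Q x) *: dg_dPhi f C PhiN x - vdiv (stage_flux PhiN Q) x.

Record leqrk_step (PhiN : R -> vfield) (Phi0 : vfield) (q0 : sfield)
    (Phi : 'I_s -> vfield) (Q : 'I_s -> sfield)
    (k : 'I_s -> vfield) (l : 'I_s -> sfield)
    (Phi1 : vfield) (q1 : sfield) : Prop := {
  stage_PhiE : forall i, {in Omega, Phi i =1 fun x =>
    Phi0 x + dt *: \sum_j a i j *: k j x};
  stage_QE : forall i, {in Omega, Q i =1 fun x =>
    q0 x + dt * \sum_j a i j * l j x};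
  stage_kE : forall i, {in Omega,
    k i =1 G (stage_potential (PhiN (stage_time i)) (Phi i) (Q i))};
  stage_lE : forall i, {in Omega, l i =1 fun x =>
    contraction (dg_dPhi f C (PhiN (stage_time i)) x) (k i x) +
    contraction (dg_dgrad f C (PhiN (stage_time i)) x) (grad (k i) x)};
  update_PhiE : {in Omega, Phi1 =1 fun x =>
    Phi0 x + dt *: \sum_i b i *: k i x};
  update_qE : {in Omega, q1 =1 fun x =>
    q0 x + dt * \sum_i b i * l i x} }.

(* The integration by parts between the flux term of [k i] and the gradient term
   of [l i] produces the boundary integral of the normal component of the
   contraction of [k i] with the flux over the state components. *)
Record regular_step (domL domG : set vfield) (PhiN : R -> vfield)
    (Phi0 : vfield) (q0 : sfield) (Phi : 'I_s -> vfield) (Q : 'I_s -> sfield)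
    (k : 'I_s -> vfield) (l : 'I_s -> sfield) : Prop := {
  extrapolation_partials : forall i, has_partials Omega (PhiN (stage_time i));
  initial_state : domL Phi0;
  initial_aux : square_integrable Omega q0;
  stage_state : forall i, domL (k i);
  stage_aux : forall i, square_integrable Omega (l i);
  flux_partials : forall i,
    has_partials Omega (stage_flux (PhiN (stage_time i)) (Q i));
  potential_dom : forall i,
    domG (stage_potential (PhiN (stage_time i)) (Phi i) (Q i));
  boundary_condition : forall i, boundary_integral_vanishes Omega
    (fun x => k i x *m stage_flux (PhiN (stage_time i)) (Q i) x) }.

End scheme.

(* Main.v *)
Require Import Defs.
From mathcomp Require Import all_boot all_order all_algebra.
From mathcomp Require Import all_classical all_reals all_analysis.
From mathcomp Require Import ring lra.
Import Order.TTheory GRing.Theory Num.Theory.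
Import numFieldNormedType.Exports.
Local Open Scope classical_set_scope.
Local Open Scope ring_scope.

(** The energy is, up to a constant, the value at the state of the two quadratic
    forms (u, L u) / 2 and (q, q), and along one step of a Runge--Kutta scheme
    any positive semi-definite quadratic form B obeys an exact identity: with
    stages U_i = u0 + dt sum_j a_ij k_j and update u1 = u0 + dt sum_i b_i k_i,

      B(u1, u1) = B(u0, u0) + 2 dt sum_i b_i B(k_i, U_i)
                  - dt^2 sum_ij M_ij B(k_i, k_j).

    To get it, expand B(u1, u1), then eliminate u0 from the cross terms
    B(k_i, u0) by u0 = U_i - dt sum_j a_ij k_j; symmetrizing the resulting
    double sum produces exactly the stability matrix M.  The last term has the
    right sign because M is positive semi-definite: a sum of rank-one matrices
    w w^T turns it into a sum of values B(v_w, v_w) with v_w = sum_i w_i k_i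
    (psd_mx_sum_rank1, sip_gram_psd_ge0).  This gives rk_step_sip_le, which is
    applied to both quadratic forms.

    It remains to see that each stage dissipates:
    (k_i, L Phi_i) + 2 (l_i, Q_i) <= 0.  Inserting the definition of l_i and
    integrating the gradient term by parts turns the left-hand side into
    (k_i, mu_i), where mu_i is the stage potential
    (stage_integration_by_parts).  This works because the same
    derivatives of g, taken at the same extrapolated state, occur in mu_i and in
    l_i, whatever that state is.  Since k_i = G mu_i, negative semi-definiteness of G concludes.

    Linearity of the integrals rests on integrability, hence on square
    integrability of the fields and on measurability of the open domain for
    the product sigma-algebra (open_measurable_row). *)

(** * Positive semi-definite matrices *)

(** Moving v along the i-th basis vector e_i: this is the quadratic form of M at
    v - t e_i, and suitable choices of t yield the elimination below. *)
Lemma psd_mx_shift {R : realType} {s : nat} {M : 'M[R]_s} :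
  psd_mx M -> forall (v : 'cV[R]_s) (i : 'I_s) (t : R),
  0 <= (v^T *m M *m v) ord0 ord0 - 2 * t * (M *m v) i ord0 + t ^+ 2 * M i i.
Proof.
move=> [symM psdM] v i t; set e : 'cV[R]_s := delta_mx i ord0.
have eM (u : 'cV[R]_s) : (e^T *m M *m u) ord0 ord0 = (M *m u) i ord0.
  by rewrite -mulmxA trmx_delta -rowE mxE.
have Me : (v^T *m M *m e) ord0 ord0 = (M *m v) i ord0.
  have -> : v^T *m M *m e = (e^T *m M *m v)^T.
    by rewrite !trmx_mul trmxK symM mulmxA.
  by rewrite mxE eM.
have Mii : (M *m e) i ord0 = M i i by rewrite -colE mxE.
have entB (X Y : 'M[R]_1) : (X - Y) ord0 ord0 = X ord0 ord0 - Y ord0 ord0.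
  by rewrite !mxE.
have entZ c (X : 'M[R]_1) : (c *: X) ord0 ord0 = c * X ord0 ord0.
  by rewrite mxE.
have := psdM (v - t *: e).
rewrite [(_ - _)^T]linearB/= [(_ *: _)^T]linearZ/= !mulmxBl !mulmxBr -!scalemxAl -!scalemxAr.
rewrite !entB !entZ !eM Me Mii => /le_trans; apply; rewrite le_eqVlt; apply/orP; left.
by apply/eqP; ring.
Qed.

(** Symmetric Gaussian elimination.  Subtracting w w^T, where w is the i-th column
    divided by the square root of a pivot M_ii > 0, leaves the Schur
    complement, which is again positive semi-definite (minimize the form of M
    over t in v - t e_i) and has one more zero on the diagonal.  When the diagonal
    vanishes, so does the matrix. *)
Lemma psd_mx_sum_rank1 {R : realType} {s : nat} {M : 'M[R]_s} :
  psd_mx M -> exists ws : seq 'cV[R]_s, M = \sum_(w <- ws) w *m w^T.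
Proof.
have [N] := ubnP #|[pred i | M i i != 0]|.
elim: N M => // N IHN M; rewrite ltnS => cardM psdM; have [symM _] := psdM.
have Mji i j : M j i = M i j by rewrite -[in LHS]symM mxE.
have diag_ge0 i : 0 <= M i i.
  by have := psd_mx_shift psdM 0 i 1; rewrite !mulmx0 !mxE; lra.
have row0 i j : M i i = 0 -> M i j = 0.
  move=> Mii0; apply/eqP/negPn/negP => Mij_neq0.
  (* The form at e_j - t e_i is M_jj - 2 t M_ij, which is -1 for this t. *)
  have := psd_mx_shift psdM (delta_mx j ord0) i ((M j j + 1) / (2 * M i j)).
  rewrite trmx_delta -rowE -!colE !mxE Mii0.
  set t := (X in 2 * X * _).
  have -> : 2 * t * M i j = M j j + 1 by rewrite /t; field.
  lra.
have [Meq0|[i Mii]] : (forall i, M i i = 0) \/ exists i, M i i != 0.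
- have [/existsP|noi] := boolP [exists i, M i i != 0]; first by right.
  by left=> i; apply/eqP; apply: contraNT noi => Mii; apply/existsP; exists i.
- exists [::]; rewrite big_nil; apply/matrixP => i j; rewrite mxE; exact: row0.
pose w : 'cV[R]_s := (Num.sqrt (M i i))^-1 *: col i M.
have sqM : (Num.sqrt (M i i))^-1 * (Num.sqrt (M i i))^-1 = (M i i)^-1.
  by rewrite -invfM -expr2 sqr_sqrtr.
have wwE j h : (w *m w^T) j h = (M i i)^-1 * M i j * M i h.
  rewrite mxE big_ord1 !mxE (Mji i j) (Mji i h) -sqM; ring.
have schurE j h : (M - w *m w^T) j h = M j h - (M i i)^-1 * M i j * M i h.
  by rewrite [LHS]mxE [X in _ + X]mxE wwE.
have [||ws Mws] := IHN (M - w *m w^T).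
- apply: leq_trans cardM; apply/proper_card/properP; split.
    apply/fintype.subsetP => j; rewrite !inE; apply: contraNN => /eqP Mjj.
    by rewrite schurE Mjj (Mji j i) (row0 _ _ Mjj) !mulr0 subrr.
  by exists i; rewrite !inE ?Mii//= negbK schurE mulVf// mul1r subrr.
- split; first by rewrite linearB/= trmx_mul trmxK symM.
  move=> v; have vw : (w^T *m v) ord0 ord0 = (Num.sqrt (M i i))^-1 * (M *m v) i ord0.
    rewrite mxE [in RHS]mxE mulr_sumr; apply: eq_bigr => j _.
    by rewrite !mxE Mji mulrA.
  rewrite mulmxBr mulmxBl mulmxA -[X in _ - X]mulmxA.
  have -> : v^T *m w = (w^T *m v)^T by rewrite trmx_mul trmxK.
  rewrite mxE [X in _ + X]mxE [X in _ - X]mxE big_ord1 [X in X * _]mxE vw.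
  (* This t minimizes the form of M at v - t e_i; the minimum is the form of
     the Schur complement at v. *)
  have := psd_mx_shift psdM v i ((M i i)^-1 * (M *m v) i ord0).
  move=> /le_trans; apply; rewrite le_eqVlt; apply/orP; left; apply/eqP.
  rewrite -[X in _ = _ - X]/(_ * _ * (_ * _)) mulrACA sqM; field; exact: Mii.
by exists (w :: ws); rewrite big_cons -Mws addrC subrK.
Qed.

(** * Runge--Kutta steps and quadratic invariants *)

(** The form is only required to be bilinear on a subspace, since integrals of
    products of arbitrary fields are not additive. *)
Record semi_inner_product {R : realType} {V : lmodType R} (D : set V)
    (B : V -> V -> R) : Prop := {
  sip_dom0 : D 0;
  sip_dom_linear : forall (a : R) u v, D u -> D v -> D (a *: u + v);
  sip_linear : forall (a : R) u v w, D u -> D v -> D w ->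
    B (a *: u + v) w = a * B u w + B v w;
  sip_sym : forall u v, D u -> D v -> B u v = B v u;
  sip_ge0 : forall u, D u -> 0 <= B u u }.

Arguments sip_dom0 {R V D B}.
Arguments sip_dom_linear {R V D B}.
Arguments sip_linear {R V D B}.
Arguments sip_sym {R V D B}.
Arguments sip_ge0 {R V D B}.

Section semi_inner_product_theory.
Context {R : realType} {V : lmodType R} {D : set V} {B : V -> V -> R}.
Context (sip : semi_inner_product D B) {s : nat}.
Implicit Types (c : 'I_s -> R) (k : 'I_s -> V).

Lemma sip_dom_sum c k : (forall i, D (k i)) -> D (\sum_i c i *: k i).
Proof.
move=> Dk; elim: (index_enum _) => [|i r IHr].
  by rewrite big_nil; exact: sip_dom0 sip.
by rewrite big_cons; apply: (sip_dom_linear sip).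
Qed.

Lemma sip_suml c k w : (forall i, D (k i)) -> D w ->
  B (\sum_i c i *: k i) w = \sum_i c i * B (k i) w.
Proof.
move=> Dk Dw; have D0 := sip_dom0 sip.
suff [] : D (\sum_i c i *: k i) /\
  B (\sum_i c i *: k i) w = \sum_i c i * B (k i) w by [].
elim: (index_enum _) => [|i r [Dr IHr]].
  rewrite !big_nil; split=> //.
  by rewrite -(addNr 0) -scaleN1r (sip_linear sip)// mulN1r addNr.
rewrite !big_cons; split; first exact: (sip_dom_linear sip).
by rewrite (sip_linear sip)// IHr.
Qed.

Lemma sip_sumr c k w : (forall i, D (k i)) -> D w ->
  B w (\sum_i c i *: k i) = \sum_i c i * B w (k i).
Proof.
move=> Dk Dw; rewrite (sip_sym sip)//; last exact: sip_dom_sum.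
by rewrite sip_suml//; apply: eq_bigr => i _; rewrite (sip_sym sip).
Qed.

(** The trace of the product of M with a Gram matrix: with M a sum of matrices
    w w^T, it is a sum of squared semi-norms. *)
Lemma sip_gram_psd_ge0 (M : 'M[R]_s) k : psd_mx M -> (forall i, D (k i)) ->
  0 <= \sum_i \sum_j M i j * B (k i) (k j).
Proof.
move=> /psd_mx_sum_rank1[ws ->] Dk.
have -> : \sum_i \sum_j (\sum_(w <- ws) w *m w^T) i j * B (k i) (k j) =
    \sum_(w <- ws) B (\sum_i w i ord0 *: k i) (\sum_i w i ord0 *: k i).
  under eq_bigr do under eq_bigr do rewrite summxE mulr_suml.
  under eq_bigr do rewrite exchange_big/=.
  rewrite exchange_big/=; apply: eq_bigr => w _.
  rewrite sip_suml//; last exact: sip_dom_sum.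
  apply: eq_bigr => i _; rewrite sip_sumr// mulr_sumr; apply: eq_bigr => j _.
  by rewrite mxE big_ord1 mxE mulrA.
by apply: sumr_ge0 => w _; apply: (sip_ge0 sip); exact: sip_dom_sum.
Qed.

(** The two sides differ by dt^2 sum_ij M_ij B(k_i, k_j), with M the stability
    matrix.  The slopes k_i are arbitrary:
    this isolates the algebraic stability of the coefficients from the
    dissipation of the gradient flow. *)
Lemma rk_step_sip_le (a : 'M[R]_s) (b : 'I_s -> R) (dt : R) (u0 : V) k :
  psd_mx (stability_mx a b) -> D u0 -> (forall i, D (k i)) ->
  let u1 := u0 + dt *: \sum_i b i *: k i in
  B u1 u1 <= B u0 u0 +
    2 * dt * \sum_i b i * B (k i) (u0 + dt *: \sum_j a i j *: k j).
Proof.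
move=> psdM Du0 Dk /=; set u1 := u0 + _.
have DK c : D (\sum_i c i *: k i) by exact: sip_dom_sum.
have DU c : D (u0 + dt *: \sum_i c i *: k i).
  by rewrite addrC; exact: (sip_dom_linear sip).
have addr c w : D w -> B w (u0 + dt *: \sum_i c i *: k i) =
    B w u0 + dt * \sum_i c i * B w (k i).
  move=> Dw; rewrite (sip_sym sip)// addrC (sip_linear sip)// sip_suml//.
  rewrite addrC (sip_sym sip)//; congr (_ + _ * _).
  by apply: eq_bigr => i _; rewrite (sip_sym sip).
pose S1 := \sum_i b i * B (k i) u0.
pose Sa := \sum_i \sum_j b i * a i j * B (k i) (k j).
pose Sb := \sum_i \sum_j b i * b j * B (k i) (k j).
have -> : \sum_i b i * B (k i) (u0 + dt *: \sum_j a i j *: k j) = S1 + dt * Sa.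
  rewrite /S1 /Sa mulr_sumr -big_split/=; apply: eq_bigr => i _.
  rewrite addr// mulrDr; congr (_ + _); rewrite mulrCA mulr_sumr.
  by congr (_ * _); apply: eq_bigr => j _; rewrite mulrA.
have -> : B u1 u1 = B u0 u0 + 2 * dt * S1 + dt ^+ 2 * Sb.
  have Bu1 w : D w -> B u1 w = B u0 w + dt * \sum_i b i * B (k i) w.
    move=> Dw; rewrite /u1 addrC (sip_linear sip)// sip_suml//.
    by rewrite addrC.
  have -> : Sb = \sum_i b i * \sum_j b j * B (k j) (k i).
    apply: eq_bigr => i _; rewrite mulr_sumr; apply: eq_bigr => j _.
    by rewrite (sip_sym sip)// mulrA.
  rewrite addr; last exact: DU.
  rewrite Bu1//.
  under [in X in _ + dt * X]eq_bigr do rewrite Bu1// mulrDr mulrCA.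
  rewrite big_split/= -mulr_sumr.
  have -> : \sum_i b i * B u0 (k i) = S1.
    by apply: eq_bigr => i _; rewrite (sip_sym sip).
  rewrite -/S1; ring.
(* Exchanging i and j symmetrizes Sa, so that 2 Sa - Sb is the sum over the
   stability matrix. *)
have gram_ge0 : 0 <= 2 * Sa - Sb.
  suff -> : 2 * Sa - Sb = \sum_i \sum_j stability_mx a b i j * B (k i) (k j).
    exact: sip_gram_psd_ge0.
  have SaE : Sa = \sum_i \sum_j b j * a j i * B (k i) (k j).
    rewrite /Sa exchange_big/=; apply: eq_bigr => i _; apply: eq_bigr => j _.
    by rewrite (sip_sym sip).
  rewrite mulr_natl mulr2n {2}SaE -big_split -sumrB; apply: eq_bigr => i _.
  rewrite -big_split -sumrB; apply: eq_bigr => j _.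
  by rewrite mxE /=; ring.
have := mulr_ge0 (sqr_ge0 dt) gram_ge0; lra.
Qed.

End semi_inner_product_theory.

(** * Square integrable fields *)

(** An open set is the union of the cubes with rational centre and radius
    1 / (N + 1) that it contains, and there are countably many of them. *)
Lemma open_measurable_row {R : realType} {m : nat} (U : set 'rV[R]_m) :
  open U -> measurable U.
Proof.
move=> oU.
pose box (c : 'rV[rat]_m) (N : nat) : set 'rV[R]_m :=
  \bigcap_i (row_coord i @^-1` ball (ratr (c ord0 i) : R) N.+1%:R^-1).
pose F (p : 'rV[rat]_m * nat) : set 'rV[R]_m :=
  if pselect (box p.1 p.2 `<=` U) then box p.1 p.2 else set0.
have -> : U = \bigcup_p F p.
  rewrite eqEsubset; split=> [x Ux|x [p _ +]]; last first.
    by rewrite /F; case: pselect => // boxU; exact: boxU.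
  have /nbhs_ballP[e/= e0 xeU] : nbhs x U by exact: open_nbhs_nbhs.
  have [N Ne] : exists N : nat, N.+1%:R^-1 < e / 2.
    have e20 : 0 < e / 2 by rewrite divr_gt0.
    have [N _ /(_ N (leqnn N))] := near_infty_natSinv_lt (PosNum e20).
    by exists N.
  have N0 : 0 < N.+1%:R^-1 :> R by [].
  have near_rat i : exists c : rat, `|ratr c - x ord0 i| < N.+1%:R^-1.
    have [c] : exists c, ratr c \in `]x ord0 i - N.+1%:R^-1, x ord0 i + N.+1%:R^-1[.
      by apply: rat_in_itvoo; rewrite ltrBlDr -addrA ltrDl addr_gt0.
    by rewrite in_itv/= -ltr_distl; exists c.
  have [c cx] := choice near_rat.
  exists (\row_i c i, N) => //; rewrite /F /=; case: pselect => [bU|[]].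
    by move=> i _ /=; rewrite /row_coord mxE /ball/=.
  move=> y boxy; apply: xeU; split=> // i j; rewrite (ord1 i).
  have /= := boxy j Logic.I; rewrite /row_coord mxE /ball/= => yc.
  have -> : x ord0 j - y ord0 j =
     (ratr (c j) - y ord0 j) - (ratr (c j) - x ord0 j) by ring.
  apply: (le_lt_trans (ler_normB _ _)).
  by rewrite (splitr e) ltrD// (lt_trans _ Ne).
apply: countable_bigcupT_measurable => [|[c N]]; first exact: countableP.
rewrite /F /=.
case: pselect => [boxU|nboxU]; last exact: measurable0.
apply: fin_bigcap_measurable => [|i _]; first exact: finite_finset.
rewrite -[X in measurable X]setTI; apply: measurable_row_coord => //.
exact: measurable_realfun.measurable_ball.
Qed.

Section square_integrable_fields.
Context {R : realType} {m : nat} {Omega : set 'rV[R]_m}.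
Context (mO : measurable Omega).
Local Notation mu := (lebesgue_row m).
Implicit Types u v w : 'rV[R]_m -> R.

Lemma square_integrable_mul u v : square_integrable Omega u ->
  square_integrable Omega v -> mu.-integrable Omega (EFin \o (u \* v)).
Proof.
move=> [meas_u iu] [meas_v iv]; apply: (le_integrable mO _ _ (integrableD mO iu iv)).
  apply/measurable_realfun.measurable_EFinP.
  exact: measurable_realfun.measurable_funM.
move=> x _ /=; rewrite lee_fin (ger0_norm (addr_ge0 (sqr_ge0 _) (sqr_ge0 _))).
rewrite normrM -(real_normK (num_real (u x))) -(real_normK (num_real (v x))).
have := sqr_ge0 (`|u x| - `|v x|); have := mulr_ge0 (normr_ge0 (u x)) (normr_ge0 (v x)).
nra.
Qed.

Lemma square_integrable_linear a u v : square_integrable Omega u ->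
  square_integrable Omega v -> square_integrable Omega (a *: u + v).
Proof.
move=> su sv; have [meas_u iu] := su; have [meas_v iv] := sv.
have mauv : measurable_fun Omega (a *: u + v).
  apply: (@measurable_realfun.measurable_funD _ _ _ _ (a *: u) v) => //.
  by apply: measurable_realfun.measurable_funM => //; exact: measurable_cst.
split=> //.
have i := integrableD mO (integrableZl mO (a ^+ 2) iu)
  (integrableD mO (integrableZl mO (2 * a) (square_integrable_mul u v su sv)) iv).
apply: (eq_integrable mO _ _ _ i) => x _ /=.
rewrite -!EFinM -!EFinD; congr EFin; rewrite !fctE /GRing.scale/=; ring.
Qed.

Lemma square_integrable_eq u v : {in Omega, u =1 v} ->
  square_integrable Omega u -> square_integrable Omega v.
Proof.
move=> uv [meas_u iu]; split; first exact: eq_measurable_fun uv meas_u.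
by apply: (eq_integrable mO _ _ _ iu) => x Ox /=; rewrite uv.
Qed.

Lemma square_integrable0 : square_integrable Omega (0 : 'rV[R]_m -> R).
Proof.
split; first exact: measurable_cst.
apply: (eq_integrable mO _ _ _ (integrable0 _ _)) => x _ /=.
by rewrite expr0n.
Qed.

Lemma eq_inner u u' v v' : {in Omega, u =1 u'} -> {in Omega, v =1 v'} ->
  inner Omega u v = inner Omega u' v'.
Proof. by move=> uu vv; apply: eq_Rintegral => x Ox; rewrite uu ?vv. Qed.

Lemma inner_linear a u v w : square_integrable Omega u ->
  square_integrable Omega v -> square_integrable Omega w ->
  inner Omega (a *: u + v) w = a * inner Omega u w + inner Omega v w.
Proof.
move=> su sv sw; have iuw := square_integrable_mul _ _ su sw.
rewrite /inner -RintegralZl// -RintegralD//; last 2 first.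
- exact: (integrableZl mO a iuw).
- exact: square_integrable_mul.
by apply: eq_Rintegral => x _; rewrite !fctE /GRing.scale/=; ring.
Qed.

Lemma innerC u v : inner Omega u v = inner Omega v u.
Proof. by apply: eq_Rintegral => x _; rewrite mulrC. Qed.

Lemma inner_ge0 u : 0 <= inner Omega u u.
Proof. by apply: Rintegral_ge0 => x _; rewrite -expr2 sqr_ge0. Qed.

End square_integrable_fields.

(* The full contraction of matrices, as opposed to contraction mappings. *)
Local Notation contraction := Defs.contraction.

Section vector_fields.
Context {R : realType} {m d : nat} {Omega : set 'rV[R]_m}.
Context (mO : measurable Omega).
Local Notation mu := (lebesgue_row m).
Implicit Types u v w : 'rV[R]_m -> 'rV[R]_d.

Lemma vinnerC u v : vinner Omega u v = vinner Omega v u.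
Proof. by apply: eq_bigr => c _; exact: innerC. Qed.

Lemma eq_vinner u u' v v' : {in Omega, u =1 u'} -> {in Omega, v =1 v'} ->
  vinner Omega u v = vinner Omega u' v'.
Proof.
by move=> uu vv; apply: eq_bigr => c _; apply: eq_inner => x Ox; rewrite ?uu ?vv.
Qed.

Lemma vinner_linear a u v w : vsquare_integrable Omega u ->
  vsquare_integrable Omega v -> vsquare_integrable Omega w ->
  vinner Omega (a *: u + v) w = a * vinner Omega u w + vinner Omega v w.
Proof.
move=> su sv sw; rewrite /vinner mulr_sumr -big_split/=; apply: eq_bigr => c _.
rewrite -(inner_linear mO)//; apply: eq_inner => // x _.
by rewrite !fctE/= !mxE.
Qed.

Lemma contraction_row (x y : 'rV[R]_d) :
  contraction x y = \sum_c x ord0 c * y ord0 c.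
Proof. by rewrite /contraction big_ord1. Qed.

Lemma integrable_contraction u v : vsquare_integrable Omega u ->
  vsquare_integrable Omega v ->
  mu.-integrable Omega (EFin \o (fun x => contraction (u x) (v x))).
Proof.
move=> su sv.
have iuv c := square_integrable_mul mO _ _ (su c) (sv c).
have i := @integrable_sum _ _ _ mu _ mO _ (index_enum _) xpredT _ (fun c _ => iuv c).
apply: (eq_integrable mO _ _ _ i) => x _ /=.
by rewrite contraction_row sumEFin.
Qed.

Lemma vinner_contraction u v : vsquare_integrable Omega u ->
  vsquare_integrable Omega v ->
  vinner Omega u v = \int[mu]_(x in Omega) contraction (u x) (v x).
Proof.
move=> su sv; under eq_Rintegral do rewrite contraction_row.
rewrite /vinner; have iuv c := square_integrable_mul mO _ _ (su c) (sv c).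
suff [] : mu.-integrable Omega
      (EFin \o (fun x => \sum_c u x ord0 c * v x ord0 c)) /\
    \sum_c inner Omega (fun x => u x ord0 c) (fun x => v x ord0 c) =
    \int[mu]_(x in Omega) \sum_c u x ord0 c * v x ord0 c by [].
elim: (index_enum _) => [|c r [ir IHr]].
  rewrite big_nil; under eq_Rintegral do rewrite big_nil.
  split; last by rewrite /Rintegral integral0.
  apply: (eq_integrable mO _ _ _ (integrable0 _ _)) => x _ /=.
  by rewrite big_nil.
rewrite big_cons; under eq_Rintegral do rewrite big_cons.
split; last by rewrite (RintegralD _ (iuv c) ir)// IHr.
apply: (eq_integrable mO _ _ _ (integrableD mO (iuv c) ir)) => x _ /=.
by rewrite big_cons.
Qed.

(** The product rule for each partial derivative of each product u_c P_cj; the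
    two resulting sums over c and j are the two contractions. *)
Lemma sdiv_mulmx (u : 'rV[R]_m -> 'rV[R]_d) (P : 'rV[R]_m -> 'M[R]_(d, m)) :
  has_partials Omega u -> has_partials Omega P ->
  forall x, Omega x -> sdiv (fun y => u y *m P y) x =
    contraction (P x) (grad u x) + contraction (u x) (vdiv P x).
Proof.
move=> du dP x Ox; rewrite /contraction big_ord1 exchange_big/=.
under [X in _ = _ + X]eq_bigr do rewrite mxE mulr_sumr.
rewrite [X in _ = _ + X]exchange_big -big_split/=; apply: eq_bigr => j _.
rewrite /partial -big_split/=.
have -> : (fun y => (u y *m P y) ord0 j) =
    \sum_(c < d) (fun y => u y ord0 c : R) * (fun y => P y c j : R).
  by apply/funext => y; rewrite mxE fct_sumE.
rewrite derive_sum => [|c]; last by apply: derivableM; [exact: du|exact: dP].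
apply: eq_bigr => c _; rewrite deriveM; [|exact: du|exact: dP].
by rewrite mxE addrC.
Qed.

(** Here v stands for L Phi and w for the stage potential.  By the product rule
    the integrands k . v + 2 l Q and k . w differ pointwise by the divergence of
    k contracted with the flux, whose integral is the vanishing boundary term.
    Writing that divergence as a difference of products of square integrable
    fields is what makes its integral split. *)
Lemma stage_integration_by_parts (k v w : 'rV[R]_m -> 'rV[R]_d)
    (l Q : 'rV[R]_m -> R) (gPhi : 'rV[R]_m -> 'rV[R]_d)
    (ggrad : 'rV[R]_m -> 'M[R]_(d, m)) :
  let flux := fun x => (2 * Q x) *: ggrad x in
  {in Omega, w =1 fun x => v x + (2 * Q x) *: gPhi x - vdiv flux x} ->
  {in Omega, l =1 fun x =>
    contraction (gPhi x) (k x) + contraction (ggrad x) (grad k x)} ->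
  has_partials Omega k -> has_partials Omega flux ->
  vsquare_integrable Omega k -> vsquare_integrable Omega v ->
  vsquare_integrable Omega w ->
  square_integrable Omega l -> square_integrable Omega Q ->
  boundary_integral_vanishes Omega (fun x => k x *m flux x) ->
  vinner Omega k v + 2 * inner Omega l Q = vinner Omega k w.
Proof.
move=> flux wE lE dk dflux sk sv sw sl sQ bc.
have ilQ := square_integrable_mul mO _ _ sl sQ.
have ikv := integrable_contraction _ _ sk sv.
have ikw := integrable_contraction _ _ sk sw.
have i2lQ : mu.-integrable Omega (EFin \o (fun x => 2 * (l x * Q x))).
  exact: (integrableZl mO 2 ilQ).
have ikv2lQ : mu.-integrable Omega
    (EFin \o (fun x => contraction (k x) (v x) + 2 * (l x * Q x))).
  exact: (integrableD mO ikv i2lQ).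
have divE : {in Omega, sdiv (fun x => k x *m flux x) =1 fun x =>
    contraction (k x) (v x) + 2 * (l x * Q x) - contraction (k x) (w x)}.
  move=> x Ox; rewrite (sdiv_mulmx _ _ dk dflux); last exact/set_mem.
  rewrite (lE _ Ox) (wE _ Ox) /=.
  have -> : contraction (flux x) (grad k x) =
      2 * Q x * contraction (ggrad x) (grad k x).
    rewrite /contraction mulr_sumr; apply: eq_bigr => c _.
    by rewrite mulr_sumr; apply: eq_bigr => j _; rewrite mxE mulrA.
  have -> : contraction (k x) (v x + 2 * Q x *: gPhi x - vdiv flux x) =
      contraction (k x) (v x) + 2 * Q x * contraction (gPhi x) (k x) -
      contraction (k x) (vdiv flux x).
    rewrite !contraction_row mulr_sumr -big_split -sumrB; apply: eq_bigr => c _.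
    have -> : (v x + 2 * Q x *: gPhi x - vdiv flux x) ord0 c =
        v x ord0 c + 2 * Q x * gPhi x ord0 c - vdiv flux x ord0 c.
      by rewrite !mxE.
    by rewrite /=; ring.
  ring.
have := bc; rewrite /boundary_integral_vanishes (eq_Rintegral _ divE).
rewrite RintegralB// RintegralD// RintegralZl//.
by rewrite !vinner_contraction// => /eqP; rewrite subr_eq0 => /eqP.
Qed.

End vector_fields.

(** * Energy stability *)

(** The element u0 only witnesses that the domain is not empty, hence contains
    0. *)
Lemma linear_operator_sip {R : realType} {m d : nat} {Omega : set 'rV[R]_m}
    {dom : set ('rV[R]_m -> 'rV[R]_d)} {L} (u0 : 'rV[R]_m -> 'rV[R]_d) :
  measurable Omega -> linear_operator Omega dom L ->
  self_adjoint Omega dom L -> positive_semidefinite Omega dom L -> dom u0 ->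
  semi_inner_product dom (fun u v => vinner Omega u (L v)).
Proof.
move=> mO linL saL psdL du0; have [dlin deq _ dsq Lsq _ _] := linL; split=> //.
- by rewrite -(addNr u0) -scaleN1r; exact: dlin.
- move=> a u v w du dv dw; apply: vinner_linear => //; by [exact: dsq|exact: Lsq].
- by move=> u v du dv; rewrite saL// vinnerC.
Qed.

Lemma inner_sip {R : realType} {m : nat} {Omega : set 'rV[R]_m} :
  measurable Omega -> semi_inner_product (square_integrable Omega) (inner Omega).
Proof.
move=> mO; split.
- exact: square_integrable0.
- exact: square_integrable_linear.
- exact: inner_linear.
- by move=> u v _ _; exact: innerC.
- by move=> u _; exact: inner_ge0.
Qed.

Theorem theorem3p1 (R : realType) (m d s : nat)
  (hm : (0 < m)%N) (hd : (0 < d)%N) (hs : (0 < s)%N)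
  (* bounded spatial domain *)
  (Omega : set 'rV[R]_m)
  (Omega_neq0 : Omega !=set0) (Omega_open : open Omega)
  (Omega_connected : connected Omega) (Omega_bounded : bounded_set Omega)
  (* energy density, with C such that f + C > 0 *)
  (f : 'rV[R]_d -> 'M[R]_(d, m) -> R) (C : R)
  (f_regular : density_regular f)
  (f_bounded_below : exists lb : R, forall y p, lb <= f y p)
  (C_gt0 : 0 < C) (fC_gt0 : forall y p, 0 < f y p + C)
  (* linear operator L *)
  (domL : set ('rV[R]_m -> 'rV[R]_d))
  (L : ('rV[R]_m -> 'rV[R]_d) -> 'rV[R]_m -> 'rV[R]_d)
  (L_linear : linear_operator Omega domL L)
  (L_self_adjoint : self_adjoint Omega domL L)
  (L_psd : positive_semidefinite Omega domL L)
  (* mobility operator *)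
  (domG : set ('rV[R]_m -> 'rV[R]_d))
  (G : 'I_d -> 'I_d -> ('rV[R]_m -> R) -> 'rV[R]_m -> R)
  (domG_square_integrable : forall v, domG v -> vsquare_integrable Omega v)
  (G_nsd : negative_semidefinite Omega domG (matrix_operator G))
  (* Runge-Kutta coefficients and stability condition *)
  (a : 'M[R]_s) (b : 'I_s -> R)
  (b_ge0 : forall i, 0 <= b i)
  (M_psd : psd_mx (stability_mx a b))
  (* one step of the scheme *)
  (dt : R) (dt_gt0 : 0 < dt) (n : nat)
  (PhiN : R -> 'rV[R]_m -> 'rV[R]_d)
  (Phi0 : 'rV[R]_m -> 'rV[R]_d) (q0 : 'rV[R]_m -> R)
  (Phi : 'I_s -> 'rV[R]_m -> 'rV[R]_d) (Q : 'I_s -> 'rV[R]_m -> R)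
  (k : 'I_s -> 'rV[R]_m -> 'rV[R]_d) (l : 'I_s -> 'rV[R]_m -> R)
  (Phi1 : 'rV[R]_m -> 'rV[R]_d) (q1 : 'rV[R]_m -> R)
  (regular : regular_step Omega L f C a dt n domL domG PhiN Phi0 q0 Phi Q k l)
  (step : leqrk_step Omega L (matrix_operator G) f C a b dt n
            PhiN Phi0 q0 Phi Q k l Phi1 q1) :
  energy C Omega L Phi1 q1 <= energy C Omega L Phi0 q0.
Proof.
have mO : measurable Omega by exact: open_measurable_row.
have sipL := linear_operator_sip _ mO L_linear L_self_adjoint L_psd
  (initial_state regular).
have sipQ := inner_sip mO.
have [_ domL_eq domL_partials domL_sq L_sq L_eq _] := L_linear.
have [PhiE QE kE lE Phi1E q1E] := step.
have [_ dPhi0 sq0 dk sl dflux dpot bc] := regular.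
(* The scheme determines its fields on Omega only; the primed fields are the
   exact linear combinations, to which the abstract estimate applies. *)
pose Phi' i := Phi0 + dt *: \sum_j a i j *: k j.
pose Q' i := q0 + dt *: \sum_j a i j *: l j.
pose Phi1' := Phi0 + dt *: \sum_i b i *: k i.
pose q1' := q0 + dt *: \sum_i b i *: l i.
have dPhi' i : domL (Phi' i).
  by rewrite /Phi' addrC; apply: (sip_dom_linear sipL) => //; apply: (sip_dom_sum sipL).
have dPhi1' : domL Phi1'.
  by rewrite /Phi1' addrC; apply: (sip_dom_linear sipL) => //; apply: (sip_dom_sum sipL).
have sQ' i : square_integrable Omega (Q' i).
  rewrite /Q' addrC; apply: (sip_dom_linear sipQ) => //.
  by apply: (sip_dom_sum sipQ).
have Phi'E i : {in Omega, Phi i =1 Phi' i}.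
  move=> x Ox; rewrite PhiE// /Phi' !fctE fct_sumE.
  by congr (_ + _ *: _); apply: eq_bigr.
have Q'E i : {in Omega, Q i =1 Q' i}.
  move=> x Ox; rewrite QE// /Q' !fctE fct_sumE.
  by congr (_ + _ * _); apply: eq_bigr.
have Phi1'E : {in Omega, Phi1 =1 Phi1'}.
  move=> x Ox; rewrite Phi1E// /Phi1' !fctE fct_sumE.
  by congr (_ + _ *: _); apply: eq_bigr.
have q1'E : {in Omega, q1 =1 q1'}.
  move=> x Ox; rewrite q1E// /q1' !fctE fct_sumE.
  by congr (_ + _ * _); apply: eq_bigr.
have symE (T : Type) (f1 f2 : 'rV[R]_m -> T) :
    {in Omega, f1 =1 f2} -> {in Omega, f2 =1 f1}.
  by move=> f12 x Ox; rewrite f12.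
have dPhi i : domL (Phi i) by exact: domL_eq (symE _ _ _ (Phi'E i)) (dPhi' i).
have sQ i : square_integrable Omega (Q i).
  exact: square_integrable_eq mO _ _ (symE _ _ _ (Q'E i)) (sQ' i).
have dPhi1 : domL Phi1 by exact: domL_eq (symE _ _ _ Phi1'E) dPhi1'.
(* Dissipation at each stage: the left-hand side is (G mu_i, mu_i). *)
have stage_le0 i : vinner Omega (k i) (L (Phi' i)) + 2 * inner Omega (l i) (Q' i) <= 0.
  rewrite -(eq_vinner (k i) (k i) (L (Phi i)) (L (Phi' i)))//; last first.
    exact: L_eq (dPhi i) (Phi'E i).
  rewrite -(eq_inner (l i) (l i) (Q i) (Q' i))//.
  rewrite (stage_integration_by_parts mO _ _
    (stage_potential L f C (PhiN (stage_time a dt n i)) (Phi i) (Q i)) _ _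
    (dg_dPhi f C (PhiN (stage_time a dt n i)))
    (dg_dgrad f C (PhiN (stage_time a dt n i))))//.
  - rewrite vinnerC (eq_vinner _ _ _ _ (fun=> fun=> erefl) (kE i)).
    exact: G_nsd.
  - exact: domL_partials.
  - exact: dflux.
  - exact: domL_sq.
  - exact: L_sq.
  - exact: domG_square_integrable.
have leL := rk_step_sip_le sipL a b dt Phi0 k M_psd dPhi0 dk.
have leQ := rk_step_sip_le sipQ a b dt q0 l M_psd sq0 sl.
rewrite /energy lerD2r.
rewrite (eq_vinner _ _ _ _ Phi1'E (L_eq _ _ dPhi1 Phi1'E)) (eq_inner _ _ _ _ q1'E q1'E).
have diss : dt * \sum_i b i *
    (vinner Omega (k i) (L (Phi' i)) + 2 * inner Omega (l i) (Q' i)) <= 0.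
  rewrite pmulr_rle0//; apply: sumr_le0 => i _.
  by rewrite mulr_ge0_le0.
move: diss leL leQ; rewrite /= -/Phi1' -/q1'.
under eq_bigr do rewrite mulrDr mulrCA.
rewrite big_split/= -mulr_sumr.
set SL := \sum_i b i * vinner _ _ _; set SQ := \sum_i b i * inner _ _ _.
rewrite -/SL -/SQ; lra.
Qed.
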